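(* Let $\lambda\in(0,1)$. The family of dynamic conditional risk mappings $((\rho_t^x)_{t\in\mathbb{N}_0})_{x\in E}$ given, for $Z\in b\mathcal{F}$, by the average value at risk $$\rho_t^x(Z)=\begin{cases}\mathrm{AVaR}^x_\lambda(-Z),&t=0,\\ \mathrm{AVaR}^x_{\lambda,t}(-Z),&t\ge1,\end{cases}$$ where $$\mathrm{AVaR}^x_\lambda(-Z)=\mathbb{E}^x\left[\mathrm{VaR}^x_\lambda(-Z)+\frac1\lambda\big(Z-\mathrm{VaR}^x_\lambda(-Z)\big)^+\right],$$ $$\mathrm{AVaR}^x_{\lambda,t}(-Z)=\mathbb{E}^x\left[\mathrm{VaR}^x_\lambda(-Z\vert\mathcal{F}_t)+\frac1\lambda\big(Z-\mathrm{VaR}^x_\lambda(-Z\vert\mathcal{F}_t)\big)^+\,\Big\vert\,\mathcal{F}_t\right]\quad(t\ge1),$$ satisfies the Markov property.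
   Context: Setting. $E$ is a Polish space with Borel $\sigma$-algebra $\mathcal{E}$; $\mathbb{N}_0=\{0,1,2,\ldots\}$; $\Omega=E^{\mathbb{N}_0}$; $X_t(\omega)=\omega(t)$ is the coordinate process; $\mathcal{F}_t=\sigma(X_s: s\le t)$ and $\mathcal{F}=\sigma(\bigcup_t\mathcal{F}_t)$. $X$ is a time-homogeneous Markov chain; $x\mapsto\mathbb{P}^x$ is a measurable map from $E$ to the probability measures on $(\Omega,\mathcal{F})$, where $\mathbb{P}^x$ is the law of the chain started at $x$ (so $\mathbb{P}^x(X_0=x)=1$), and $\mathbb{E}^x$ is expectation under $\mathbb{P}^x$. The shifts $\theta_t:\Omega\to\Omega$ satisfy $X_s\circ\theta_t=X_{t+s}$. $b\mathcal{G}$ denotes the bounded $\mathcal{G}$-measurable real random variables. Inequalities between random variables are understood $\mathbb{P}^x$-a.s. Value at risk: $\mathrm{VaR}^x_\lambda(-Z):=\inf\{m\in\mathbb{R}:\mathbb{P}^x(m<Z)\le\lambda\}$ and, for $t\ge1$, $\mathrm{VaR}^x_\lambda(-Z\vert\mathcal{F}_t):=\mathbb{P}^x\text{-}\operatorname{ess\,inf}\{m_t\in b\mathcal{F}_t:\mathbb{P}^x(m_t<Z\vert\mathcal{F}_t)\le\lambda\}$. Risk mapping on $(\Omega,\mathcal{F},\mathbb{P}^x)$: a function $\rho^x:b\mathcal{F}\to\mathbb{R}$ with $\rho^x(0)=0$; $\rho^x(Z+c)=c+\rho^x(Z)$ for $Z\in b\mathcal{F}$, $c\in\mathbb{R}$;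 and $Z\le Z'$ $\mathbb{P}^x$-a.s. implies $\rho^x(Z)\le\rho^x(Z')$. Conditional risk mapping on $(\Omega,\mathcal{F},\mathbb{P}^x)$ with respect to $\mathcal{F}_t$: a function $\rho^x_t:b\mathcal{F}\to b\mathcal{F}_t$ with $\rho_t^x(0)=0$ $\mathbb{P}^x$-a.s.; $\rho_t^x(Z+Z')=Z'+\rho_t^x(Z)$ $\mathbb{P}^x$-a.s. for $Z\in b\mathcal{F}$, $Z'\in b\mathcal{F}_t$; and $Z\le Z'$ $\mathbb{P}^x$-a.s. implies $\rho_t^x(Z)\le\rho_t^x(Z')$ $\mathbb{P}^x$-a.s. Dynamic conditional risk mapping on $(\Omega,\mathcal{F},(\mathcal{F}_t),\mathbb{P}^x)$: a sequence $(\rho_t^x)_{t\in\mathbb{N}_0}$ where $\rho_0^x$ is a risk mapping and, for $t\ge1$, $\rho_t^x$ is a conditional risk mapping with respect to $\mathcal{F}_t$. Write $\rho^x:=\rho_0^x$. Regularity: $(\rho^x)_{x\in E}$ is regular if for all $Z\in b\mathcal{F}$ the map $x\mapsto\rho^x(Z)$ is bounded and measurable. Markov property: a family $\varrho=((\rho_t^x)_{t\in\mathbb{N}_0})_{x\in E}$ of dynamic conditional risk mappings satisfies the Markov property (is Markovian) if $(\rho^x_0)_{x\in E}$ is regular and for each $x\in E$, $Z\in b\mathcal{F}$, $t\in\mathbb{N}_0$: $\rho_t^x(Z\circ\theta_t)=\rho^{X_t}(Z)$ $\mathbb{P}^x$-a.s., where $\rho^{X_t}(Z)$ is $\omega\mapsto\rho^{X_t(\omega)}(Z)$.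 *)

(* Defs.v *)
From HB Require Import structures.
From mathcomp Require Import all_boot all_order all_algebra.
From mathcomp Require Import all_classical all_reals all_analysis.

Set Implicit Arguments.
Unset Strict Implicit.
Unset Printing Implicit Defensive.

Import Order.TTheory GRing.Theory Num.Theory.
Import numFieldNormedType.Exports.

Local Open Scope classical_set_scope.
Local Open Scope ring_scope.

Definition polish_space (R : realType) (E : topologicalType) : Prop :=
  (exists2 D : set E, countable D & dense D) /\
  exists d : E -> E -> R,
    [/\ (forall x y, d x y = 0 <-> x = y),
        (forall x y, d x y = d y x),
        (forall x y z, d x z <= d x y + d y z),
        (forall x (A : set E),
           nbhs x A <-> exists2 e, 0 < e & [set y | d x y < e] `<=` A) &
        (forall u : nat -> E,
           (forall e, 0 < e -> exists N, forall m n,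
              (N <= m)%N -> (N <= n)%N -> d (u m) (u n) < e) ->
           exists l : E, u @ \oo --> l)].

Definition borel (E : ptopologicalType) := g_sigma_algebraType (@open E).

Definition filtration (E : ptopologicalType) (t : nat) : set (set (nat -> E)) :=
  <<s \bigcup_(s in [set s | (s <= t)%N])
        preimage_set_system setT (fun w : nat -> E => w s : borel E)
          (@measurable _ (borel E)) >>.

Definition path_space (E : ptopologicalType) :=
  g_sigma_algebraType (\bigcup_t @filtration E t).

Definition time_shift (E : ptopologicalType) (t : nat) (w : path_space E) : path_space E :=
  fun s => w (t + s)%N.

Definition measurable_wrt (T : Type) (R : realType) (G : set (set T))
    (Z : T -> R) : Prop :=
  forall B : set R, measurable B -> G (Z @^-1` B).

Definition bounded_rv (T : Type) (R : realType) (G : set (set T)) :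
    set (T -> R) :=
  [set Z | measurable_wrt G Z /\ bounded_fun Z].

Section probability_notions.
Context d (T : measurableType d) (R : realType).
Implicit Types (P : probability T R) (G : set (set T)) (Y Z m : T -> R).

Definition is_condexp P G Z Y : Prop :=
  [/\ measurable_wrt G Y,
      P.-integrable setT (EFin \o Y) &
      forall A, G A -> (\int[P]_(w in A) (Y w)%:E = \int[P]_(w in A) (Z w)%:E)%E].

(* A chosen version (0 if there is none); two versions agree P-a.s. *)
Definition condexp P G Z : T -> R := xget (cst 0) [set Y | is_condexp P G Z Y].

(* The P-a.s. greatest random variable that is P-a.s. below every member of the
   family C; not the library's [ess_inf], which is that of one function. *)
Definition is_ess_infimum P (C : set (T -> R)) m : Prop :=
  [/\ measurable_fun setT m,
      forall c, C c -> \forall w \ae P, m w <= c w &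
      forall n : T -> R, measurable_fun setT n ->
        (forall c, C c -> \forall w \ae P, n w <= c w) ->
        \forall w \ae P, n w <= m w].

(* A chosen version (0 if there is none); two versions agree P-a.s. *)
Definition ess_infimum P (C : set (T -> R)) : T -> R :=
  xget (cst 0) [set m | is_ess_infimum P C m].

(* Below, the argument Z is the loss: [VaR lam P Z] is VaR_lam(-Z), and likewise
   for the other three. *)

Definition VaR (lam : R) P Z : R :=
  inf [set m : R | (P [set w | m < Z w]%R <= lam%:E)%E].

Definition cond_VaR (lam : R) P G Z : T -> R :=
  ess_infimum P
    [set m | bounded_rv G m /\
       \forall w \ae P, condexp P G (\1_[set w | m w < Z w]) w <= lam].

Definition AVaR (lam : R) P Z : R :=
  let v := VaR lam P Z in
  fine ('E_P[fun w => v + lam^-1 * Num.max (Z w - v) 0]).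

Definition cond_AVaR (lam : R) P G Z : T -> R :=
  let v := cond_VaR lam P G Z in
  condexp P G (fun w => v w + lam^-1 * Num.max (Z w - v w) 0).

(* A map on bF is represented by a total function on T -> R of which only the
   values at elements of [bounded_rv measurable] matter. *)

Definition risk_mapping P (rho : (T -> R) -> R) : Prop :=
  let bF := @bounded_rv T R measurable in
  [/\ rho (cst 0) = 0,
      forall Z c, bF Z -> rho (fun w => Z w + c) = c + rho Z &
      forall Z Z', bF Z -> bF Z' ->
        (\forall w \ae P, Z w <= Z' w) -> rho Z <= rho Z'].

Definition cond_risk_mapping P G (rho : (T -> R) -> (T -> R)) : Prop :=
  let bF := @bounded_rv T R measurable in
  let bG := @bounded_rv T R G in
  [/\ forall Z, bF Z -> bG (rho Z),
      \forall w \ae P, rho (cst 0) w = 0,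
      forall Z Z', bF Z -> bG Z' ->
        \forall w \ae P, rho (fun u => Z u + Z' u) w = Z' w + rho Z w &
      forall Z Z', bF Z -> bF Z' -> (\forall w \ae P, Z w <= Z' w) ->
        \forall w \ae P, rho Z w <= rho Z' w].

(* [rho_succ s] is the mapping at time s.+1. *)
Record dynamic_mapping := DynamicMapping {
  rho_zero : (T -> R) -> R ;
  rho_succ : nat -> (T -> R) -> (T -> R) }.

Definition rho_at (r : dynamic_mapping) (t : nat) (Z : T -> R) : T -> R :=
  if t is s.+1 then rho_succ r s Z else cst (rho_zero r Z).

Definition dynamic_risk_mapping P (F : nat -> set (set T))
    (r : dynamic_mapping) : Prop :=
  risk_mapping P (rho_zero r) /\
  forall t, (0 < t)%N -> cond_risk_mapping P (F t) (rho_at r t).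

End probability_notions.

Section markov.
Context (R : realType) (E : ptopologicalType).
Implicit Types (P : E -> probability (path_space E) R)
  (rho : E -> dynamic_mapping (path_space E) R).

Local Notation bF := (@bounded_rv (path_space E) R measurable).

(* The one-step transition kernel is p(y, A) = P^y(X_1 \in A), which is forced
   by P^y(X_0 = y) = 1; the last clause reads
   P^x(X_(t+1) \in A | F_t) = p(X_t, A) a.s. *)
Definition markov_chain P : Prop :=
  [/\ measurable_fun (setT : set (borel E)) (P : borel E -> pprobability (path_space E) R),
      forall x, P x [set w | w 0%N = x] = 1%E &
      forall x t (A : set (borel E)), measurable A ->
        is_condexp (P x) (@filtration E t) (\1_[set w : path_space E | A (w t.+1)])
          (fun w => fine (P (w t) [set w' : path_space E | A (w' 1%N)]))].

Definition regular rho : Prop :=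
  forall Z : path_space E -> R, bF Z ->
    bounded_fun (fun x => rho_zero (rho x) Z) /\
    measurable_fun (setT : set (borel E))
      (fun x : borel E => rho_zero (rho x) Z).

Definition markovian P rho : Prop :=
  [/\ forall x, dynamic_risk_mapping (P x) (@filtration E) (rho x),
      regular rho &
      forall x (Z : path_space E -> R) t, bF Z ->
        \forall w \ae P x,
          rho_at (rho x) t (Z \o @time_shift E t) w = rho_zero (rho (w t)) Z].

(* For t >= 1 the defining formula determines rho_t^x(Z) only P^x-a.s.: any version
   with values in bF_t is allowed. *)
Definition AVaR_family (lam : R) P rho : Prop :=
  (forall x (Z : path_space E -> R), bF Z -> rho_zero (rho x) Z = AVaR lam (P x) Z) /\
  (forall x t (Z : path_space E -> R), (0 < t)%N -> bF Z ->
     bounded_rv (@filtration E t) (rho_at (rho x) t Z) /\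
     \forall w \ae P x,
       rho_at (rho x) t Z w = cond_AVaR lam (P x) (@filtration E t) Z w).

End markov.

(* Main.v *)
(* The path that follows [w] up to time [t] and afterwards an independent path
   drawn from P^(w t) gives an explicit regular conditional law K_t(w, .) of the
   chain given F_t: the identity  int K_t(w, B) P^x(dw) = P^x(B)  is proved on each
   F_n by induction on n, the step being the one-step Markov property under P^x and
   under P^(w t).  Against this kernel every conditional object becomes a pathwise
   one: E^x[Z | F_t] = K_t(., Z), hence VaR(-Z | F_t) is the value at risk of Z under
   K_t(w, .) and AVaR_t(-Z) is its average value at risk under K_t(w, .).  The axioms
   of a conditional risk mapping are inherited from those of AVaR under a fixed
   probability, and the Markov property holds because, if w'(0) = w(t), the shift by
   [t] undoes the gluing of w' to w. *)
Require Import Defs.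
From HB Require Import structures.
From mathcomp Require Import all_boot all_order all_algebra.
From mathcomp Require Import all_classical all_reals all_analysis.
From mathcomp Require Import measurable_realfun giry lra.
Import Order.TTheory GRing.Theory Num.Theory.
Import numFieldNormedType.Exports.
Local Open Scope classical_set_scope.
Local Open Scope ring_scope.
Set Implicit Arguments.
Unset Strict Implicit.

(** * Value at risk under one probability measure *)

Lemma bounded_fun_ubP (T : Type) (R : realType) (Z : T -> R) :
  bounded_fun Z <-> exists M, forall w, `|Z w| <= M.
Proof.
split=> [[M [_ bM]]|[M bM]].
  by exists (M + 1) => w; apply: bM => //; rewrite ltrDl.
exists M; split; first exact: num_real.
by move=> N MN w _; exact: le_trans (bM w) (ltW MN).
Qed.

Lemma measurable_wrtE d (T : measurableType d) (R : realType) (Z : T -> R) :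
  measurable_wrt measurable Z <-> measurable_fun setT Z.
Proof.
split=> [mZ _ B mB|mZ B mB]; first by rewrite setTI; exact: mZ.
by rewrite -[X in measurable X]setTI; exact: mZ.
Qed.

Lemma Rintegral_probability_cst d (T : measurableType d) (R : realType)
    (P : probability T R) (c : R) : \int[P]_w c = c.
Proof.
by rewrite Rintegral_cst// -[X in fine X]/(P setT) probability_setT mulr1.
Qed.

Lemma bounded_integrable d (T : measurableType d) (R : realType)
    (P : probability T R) (A : set T) (Z : T -> R) (M : R) :
  measurable A -> measurable_fun setT Z -> (forall w, `|Z w| <= M) ->
  P.-integrable A (EFin \o Z).
Proof.
move=> mA mZ bZ; apply: measurable_bounded_integrable => //.
- by rewrite (le_lt_trans (probability_le1 P mA))// ltry.
- exact: measurable_funS mZ.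
- exists M; split; first exact: num_real.
  by move=> N MN w _; exact: le_trans (bZ w) (ltW MN).
Qed.

Section tail_lemmas.
Context d (T : measurableType d) (R : realType) (P : probability T R).
Implicit Types Z : T -> R.

Lemma measurable_superlevel Z (m : R) : measurable_fun setT Z ->
  measurable [set w | m < Z w].
Proof.
move=> mZ; rewrite [X in measurable X](_ : _ = Z @^-1` `]m, +oo[).
  by rewrite -[X in measurable X]setTI; exact: mZ.
by apply/seteqP; split=> w /=; rewrite in_itv/= andbT.
Qed.

Lemma probability_mono_ae (A B : set T) : measurable A -> measurable B ->
  (\forall w \ae P, A w -> B w) -> (P A <= P B)%E.
Proof.
move=> mA mB [N [mN N0 sN]].
have AN : A `<=` B `|` N.
  move=> w Aw; have [Nw|nNw] := pselect (N w); [by right|left].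
  by apply: contrapT => Bw; apply: nNw; apply: sN => /(_ Aw).
apply: (@le_trans _ _ (P (B `|` N))).
  by rewrite le_measure ?inE//; exact: measurableU.
apply: le_trans (measureU2 _ mB mN) _.
rewrite -[leRHS]adde0; apply: leeD2l.
by rewrite -[leLHS]/(P N) N0.
Qed.

End tail_lemmas.

Section value_at_risk.
Context d (T : measurableType d) (R : realType) (P : probability T R).
Context (lam : R) (lam_gt0 : 0 < lam) (lam_lt1 : lam < 1).
Implicit Types Z : T -> R.

Let S Z := [set m : R | (P [set w | m < Z w]%R <= lam%:E)%E].

Let VaR_set_lbound Z (a m : R) : (forall w, a <= Z w) ->
  S Z m -> a <= m.
Proof.
move=> aZ; rewrite /S/= => Sm; rewrite leNgt; apply/negP => ma.
have ZT : [set w | m < Z w] = setT.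
  by apply/seteqP; split=> w //= _; exact: lt_le_trans (aZ w).
by move: Sm; rewrite ZT probability_setT lee_fin leNgt lam_lt1.
Qed.

Let VaR_set_ub Z (b : R) : (forall w, Z w <= b) -> S Z b.
Proof.
move=> Zb; rewrite /S/= (_ : [set w | b < Z w] = set0) ?measure0 ?lee_fin ?ltW//.
by apply/seteqP; split=> w //=; rewrite ltNge Zb.
Qed.

Let VaR_has_inf Z (a b : R) : (forall w, a <= Z w) -> (forall w, Z w <= b) ->
  has_inf (S Z).
Proof.
move=> aZ Zb; split; first by exists b; exact: VaR_set_ub.
by exists a => m; exact: VaR_set_lbound.
Qed.

Lemma VaR_lb Z (a b : R) : (forall w, a <= Z w) -> (forall w, Z w <= b) ->
  a <= VaR lam P Z.
Proof.
move=> aZ Zb; apply: lb_le_inf; first by exists b; exact: VaR_set_ub.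
by move=> m; exact: VaR_set_lbound.
Qed.

Lemma VaR_ub Z (a b : R) : (forall w, a <= Z w) -> (forall w, Z w <= b) ->
  VaR lam P Z <= b.
Proof.
move=> aZ Zb; apply: ge_inf; last exact: VaR_set_ub.
by exists a => m; exact: VaR_set_lbound.
Qed.

(** The event [m < Z] is the increasing union of the events [m + 1/(n+1) < Z], so the tail
    probability is right-continuous in [m] and the infimum is attained. Translation, monotonicity,
    measurability in a kernel and the conditional version all go through this equivalence. *)
Lemma VaR_le_iff Z (M m : R) :
  measurable_fun setT Z -> (forall w, `|Z w| <= M) ->
  (VaR lam P Z <= m) = (P [set w | m < Z w]%R <= lam%:E)%E.
Proof.
move=> mZ bZ.
have aZ w : - M <= Z w by have := bZ w; rewrite ler_norml => /andP[].
have Zb w : Z w <= M by have := bZ w; rewrite ler_norml => /andP[].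
apply/idP/idP => [vm|]; last first.
  move=> Sm; apply: ge_inf => //.
  by exists (- M) => k; exact: VaR_set_lbound.
pose F n := [set w | m + n.+1%:R^-1 < Z w].
have mF n : measurable (F n) by exact: measurable_superlevel.
have FE : [set w | m < Z w] = \bigcup_n F n.
  apply/seteqP; split=> w /=; last first.
    by move=> [n _]; apply: lt_trans; rewrite ltrDl.
  move=> mw; have /ltr_add_invr[n hn] := mw.
  by exists n.
have ndF : nondecreasing_seq F.
  move=> i j ij; rewrite subsetEset => w; rewrite /F/=; apply: le_lt_trans.
  by rewrite lerD2l lef_pV2 ?posrE// ler_nat.
have cF : P \o F @ \oo --> P (\bigcup_n F n).
  by apply: nondecreasing_cvg_mu => //; exact: bigcupT_measurable.
rewrite FE -(cvg_lim _ cF)//.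
apply: lime_le; first exact: cvgP cF.
apply: nearW => n /=.
have vn : inf (S Z) < m + n.+1%:R^-1 by rewrite (le_lt_trans vm)// ltrDl.
have [s Ss sn] := inf_lt (VaR_has_inf aZ Zb).1 vn.
apply: le_trans _ Ss.
rewrite le_measure ?inE//; first exact: measurable_superlevel.
by move=> w; rewrite /F/=; exact: lt_trans.
Qed.

Lemma VaR_translate Z (M c : R) :
  measurable_fun setT Z -> (forall w, `|Z w| <= M) ->
  VaR lam P (fun w => Z w + c) = c + VaR lam P Z.
Proof.
move=> mZ bZ.
have bZ' w : `|Z w + c| <= M + `|c| by rewrite (le_trans (ler_normD _ _))// lerD2r.
have mZ' : measurable_fun setT (fun w => Z w + c) by exact: measurable_funD.
(* Two reals with the same upper bounds are equal. *)
have key m : (VaR lam P (fun w => Z w + c) <= m) = (c + VaR lam P Z <= m).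
  rewrite (VaR_le_iff _ mZ' bZ') -lerBrDl (VaR_le_iff _ mZ bZ).
  by under eq_set do rewrite -ltrBlDr.
by apply/eqP; rewrite eq_le key lexx -key lexx.
Qed.

Lemma VaR_mono Z Z' (M M' : R) :
  measurable_fun setT Z -> (forall w, `|Z w| <= M) ->
  measurable_fun setT Z' -> (forall w, `|Z' w| <= M') ->
  (\forall w \ae P, Z w <= Z' w) -> VaR lam P Z <= VaR lam P Z'.
Proof.
move=> mZ bZ mZ' bZ' ZZ'.
rewrite (VaR_le_iff _ mZ bZ).
have := lexx (VaR lam P Z'); rewrite (VaR_le_iff _ mZ' bZ').
apply: le_trans; apply: probability_mono_ae; try exact: measurable_superlevel.
by apply: filterS ZZ' => w /[swap] /lt_le_trans /[apply].
Qed.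

Lemma VaR_norm Z (M : R) : (forall w, `|Z w| <= M) -> `|VaR lam P Z| <= M.
Proof.
move=> bZ.
have aZ w : - M <= Z w by have := bZ w; rewrite ler_norml => /andP[].
have Zb w : Z w <= M by have := bZ w; rewrite ler_norml => /andP[].
by rewrite ler_norml (VaR_lb aZ Zb) (VaR_ub aZ Zb).
Qed.

(** * Excess over a level and average value at risk *)

Definition excess Z (m : R) : T -> R := fun w => Num.max (Z w - m) 0.

Lemma measurable_excess Z m : measurable_fun setT Z ->
  measurable_fun setT (excess Z m).
Proof.
by move=> mZ; apply: measurable_maxr => //; exact: measurable_funB.
Qed.

Lemma excess_norm Z (M m : R) : (forall w, `|Z w| <= M) ->
  forall w, `|excess Z m w| <= M + `|m|.
Proof.
move=> bZ w; rewrite /excess; have M0 : 0 <= M by exact: le_trans (bZ w).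
have := bZ w; rewrite !ler_norml => /andP[h1 h2].
have := ler_norm m; have := ler_norm (- m); rewrite normrN => h3 h4.
by apply/andP; split; case: (leP (Z w - m) 0) => h; lra.
Qed.

Lemma excess_integrable Z (M m : R) :
  measurable_fun setT Z -> (forall w, `|Z w| <= M) ->
  P.-integrable setT (EFin \o excess Z m).
Proof.
move=> mZ bZ; apply: bounded_integrable (excess_norm m bZ) => //.
exact: measurable_excess.
Qed.

Lemma AVaR_def Z (M : R) :
  measurable_fun setT Z -> (forall w, `|Z w| <= M) ->
  AVaR lam P Z = VaR lam P Z +
    lam^-1 * (\int[P]_w excess Z (VaR lam P Z) w).
Proof.
move=> mZ bZ; rewrite /AVaR unlock -/(Rintegral P setT _).
have iE := excess_integrable (VaR lam P Z) mZ bZ.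
rewrite RintegralD//.
- rewrite Rintegral_probability_cst.
  congr (_ + _).
  exact: RintegralZl.
- exact: (@bounded_integrable _ _ _ _ _ _ `|VaR lam P Z|).
- apply: (@bounded_integrable _ _ _ _ _ _
    (lam^-1 * (M + `|VaR lam P Z|))) => //.
    by apply: measurable_funM => //; exact: measurable_excess.
  move=> w; rewrite normrM gtr0_norm ?invr_gt0// ler_pM2l ?invr_gt0//.
  exact: excess_norm.
Qed.

(* [VaR lam P Z] minimises the right-hand side over all [m] (Rockafellar-Uryasev);
   only [m] above [VaR] is needed, where the loss in the first summand is paid for by
   the event [Z > VaR], of probability at most [lam]. *)
Lemma AVaR_le_above Z (M m : R) :
  measurable_fun setT Z -> (forall w, `|Z w| <= M) -> VaR lam P Z <= m ->
  AVaR lam P Z <= m + lam^-1 * (\int[P]_w excess Z m w).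
Proof.
move=> mZ bZ vm; rewrite (AVaR_def mZ bZ).
set v := VaR lam P Z; set A := [set w | v < Z w].
have mA : measurable A by exact: measurable_superlevel.
have PA : fine (P A) <= lam.
  have := lexx v; rewrite {1}/v (VaR_le_iff _ mZ bZ) -/A => PA.
  by rewrite -lee_fin fineK// fin_num_measure.
have i1 : P.-integrable setT (EFin \o (fun w => (m - v) * \1_A w)).
  apply: (@bounded_integrable _ _ _ _ _ _ `|m - v|) => //.
    by apply: measurable_funM => //; exact: measurable_indic.
  by move=> w; rewrite indicE; case: (w \in A); rewrite ?mulr1// mulr0 normr0.
have i2 := excess_integrable m mZ bZ.
(* Pointwise, as [v <= m]: on [A] the two excesses differ by at most [m - v], and off [A] both
   vanish. *)
have : \int[P]_w excess Z v w <=
       \int[P]_w (excess Z m w + (m - v) * \1_A w).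
  apply: le_Rintegral => //.
  - exact: excess_integrable mZ bZ.
  - exact: (integrableD measurableT i2 i1).
  - move=> w _; rewrite /excess indicE.
    case: (ltP v (Z w)) => [vZ|Zv].
      have -> : w \in A by rewrite inE.
      rewrite mulr1.
      by case: (leP (Z w - v) 0) => h1; case: (leP (Z w - m) 0) => h2; lra.
    have /negbTE -> : w \notin A by apply/negP; rewrite inE /A/= ltNge Zv.
    rewrite mulr0.
    by case: (leP (Z w - v) 0) => h1; case: (leP (Z w - m) 0) => h2; lra.
rewrite RintegralD// RintegralZl//; last first.
  apply: (@bounded_integrable _ _ _ _ _ _ 1) => // w.
  by rewrite indicE; case: (w \in A); rewrite ?normr1 ?normr0.
have -> : \int[P]_x \1_A x = fine (P A).
  by rewrite /Rintegral integral_indic// setIT.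
have mv : 0 <= m - v by rewrite subr_ge0.
move=> h; have h1 := le_trans h (lerD (lexx _) (ler_wpM2l mv PA)).
have l0 : 0 <= lam^-1 by rewrite invr_ge0 ltW.
have := ler_wpM2l l0 h1; rewrite mulrDr mulrCA mulVf ?gt_eqF// mulr1.
lra.
Qed.

(** The values at risk of [Z] and [Z'] may differ, so the excesses are compared at the single level
    [VaR lam P Z']. It lies above [VaR lam P Z], so [AVaR_le_above] applies to [Z] at this level. *)
Lemma AVaR_mono Z Z' (M M' : R) :
  measurable_fun setT Z -> (forall w, `|Z w| <= M) ->
  measurable_fun setT Z' -> (forall w, `|Z' w| <= M') ->
  (\forall w \ae P, Z w <= Z' w) -> AVaR lam P Z <= AVaR lam P Z'.
Proof.
move=> mZ bZ mZ' bZ' ZZ'.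
apply: le_trans (AVaR_le_above mZ bZ (VaR_mono mZ bZ mZ' bZ' ZZ')) _.
rewrite (AVaR_def mZ' bZ') lerD2l ler_pM2l ?invr_gt0//.
set v := VaR lam P Z'.
have iE := excess_integrable v mZ bZ; have iE' := excess_integrable v mZ' bZ'.
apply: fine_le; try exact: integrable_fin_num.
apply: ae_ge0_le_integral => //.
- by move=> w _; rewrite lee_fin /excess le_max lexx orbT.
- exact: measurable_int iE.
- by move=> w _; rewrite lee_fin /excess le_max lexx orbT.
- exact: measurable_int iE'.
- apply: filterS ZZ' => w h _; rewrite lee_fin /excess.
  by case: (leP (Z w - v) 0) => h1; case: (leP (Z' w - v) 0) => h2; lra.
Qed.

Lemma eq_AVaR Z Z' (M M' : R) :
  measurable_fun setT Z -> (forall w, `|Z w| <= M) ->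
  measurable_fun setT Z' -> (forall w, `|Z' w| <= M') ->
  (\forall w \ae P, Z w = Z' w) -> AVaR lam P Z = AVaR lam P Z'.
Proof.
move=> mZ bZ mZ' bZ' ZZ'; apply/eqP; rewrite eq_le.
by rewrite (AVaR_mono mZ bZ mZ' bZ') 1?(AVaR_mono mZ' bZ' mZ bZ)//;
  apply: filterS ZZ' => w ->.
Qed.

Lemma AVaR_translate Z (M c : R) :
  measurable_fun setT Z -> (forall w, `|Z w| <= M) ->
  AVaR lam P (fun w => Z w + c) = c + AVaR lam P Z.
Proof.
move=> mZ bZ.
have bZ' w : `|Z w + c| <= M + `|c| by rewrite (le_trans (ler_normD _ _))// lerD2r.
have mZ' : measurable_fun setT (fun w => Z w + c) by exact: measurable_funD.
rewrite (AVaR_def mZ' bZ') (AVaR_def mZ bZ) (VaR_translate c mZ bZ) -addrA.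
congr (_ + (_ + _ * _)); apply: eq_Rintegral => w _; rewrite /excess.
by congr Num.max; lra.
Qed.

Lemma AVaR0 : AVaR lam P (cst 0) = 0.
Proof.
have v0 : VaR lam P (cst 0) = 0.
  by apply/eqP; rewrite eq_le (VaR_lb (b := 0)) ?(VaR_ub (a := 0)).
rewrite (@AVaR_def _ 0)//; last by move=> w; rewrite normr0.
rewrite v0 add0r (_ : \int[P]_w _ = 0) ?mulr0//.
rewrite /Rintegral (eq_integral (cst 0%E)) ?integral0// => w _.
by rewrite /excess subrr maxxx.
Qed.

Lemma AVaR_cst c : AVaR lam P (cst c) = c.
Proof.
have -> : cst c = (fun w : T => cst 0 w + c) by apply/funext => w /=; rewrite add0r.
by rewrite (@AVaR_translate _ 0) ?AVaR0 ?addr0// => w; rewrite normr0.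
Qed.

Lemma AVaR_norm Z (M : R) : measurable_fun setT Z -> (forall w, `|Z w| <= M) ->
  `|AVaR lam P Z| <= M.
Proof.
move=> mZ bZ; have bc (c : R) (w : T) : `|cst c w| <= `|c| by [].
rewrite ler_norml; apply/andP; split.
  rewrite -(AVaR_cst (- M)); apply: (AVaR_mono _ (bc _) mZ bZ) => //.
  by apply/aeW => w; have := bZ w; rewrite ler_norml => /andP[].
rewrite -[leRHS](AVaR_cst M); apply: (AVaR_mono mZ bZ _ (bc _)) => //.
by apply/aeW => w; have := bZ w; rewrite ler_norml => /andP[].
Qed.

End value_at_risk.

(** * Measurable dependence of value at risk and average value at risk on a kernel *)

Lemma measurable_fun_le (d : measure_display) (T : measurableType d)
    (R : realType) (f : T -> R) :
  (forall m, measurable [set w | f w <= m]) -> measurable_fun setT f.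
Proof.
move=> mf; apply: (measurability _ (RGenOInfty.measurableE R)) => //.
move=> _ [_ [m ->] <-]; rewrite setTI.
rewrite [X in measurable X](_ : _ = ~` [set w | f w <= m]).
  exact: measurableC.
by apply/seteqP; split=> w /=; rewrite in_itv/= andbT ltNge => /negP.
Qed.

Section kernel_measurability.
Context d d' (X : measurableType d) (T : measurableType d') (R : realType).
Context (k : X -> probability T R)
  (mk : measurable_fun setT (k : X -> pprobability T R)).

(** Adding [M] makes the integrand nonnegative, where measurability of kernel integrals applies;
    since each [k x] has mass one, the shift is undone by subtracting [M]. *)
Lemma measurable_Rintegral_kernel (f : X * T -> R) (M : R) :
  measurable_fun setT f -> (forall z, `|f z| <= M) ->
  measurable_fun setT (fun x => \int[k x]_y f (x, y)).
Proof.
move=> mf bf.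
have M0 z : (0 <= (f z + M)%:E)%E.
  by rewrite lee_fin; have := bf z; rewrite ler_norml; lra.
have mfM : measurable_fun setT (fun z => (f z + M)%:E).
  by apply/measurable_EFinP; exact: measurable_funD.
have := measurable_fun_integral_finite_kernel (fun z => (f z + M)%:E)
  (kprobability mk) M0 mfM.
rewrite /kprobability /= => mI.
rewrite (_ : (fun x => _) =
    (fun x => fine (\int[k x]_y (f (x, y) + M)%:E)%E - M)).
  by apply: measurable_funB => //; apply: measurableT_comp mI; exact: fine_measurable.
apply/funext => x; rewrite -/(Rintegral (k x) setT _) RintegralD//.
- rewrite Rintegral_probability_cst.
  by rewrite addrK.
- apply: (@bounded_integrable _ _ _ _ _ _ M) => //.
  exact: measurableT_comp.
- exact: (@bounded_integrable _ _ _ _ _ _ `|M|).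
Qed.

Context (lam : R) (lam_gt0 : 0 < lam) (lam_lt1 : lam < 1).
Context (f : X * T -> R) (M : R).
Context (mf : measurable_fun setT f) (bf : forall z, `|f z| <= M).

Let mfx x : measurable_fun setT (fun y => f (x, y)).
Proof. exact: measurableT_comp. Qed.

(** By [VaR_le_iff] a sublevel set of the value at risk is a sublevel set of the kernel mass of the
    sections of the event [m < f]. *)
Lemma measurable_VaR_kernel :
  measurable_fun setT (fun x => VaR lam (k x) (fun y => f (x, y))).
Proof.
apply: measurable_fun_le => m.
pose A := [set z | m < f z].
have mA : measurable A by exact: measurable_superlevel.
have mP : measurable_fun setT (fun x => k x (xsection A x)).
  apply: (measurable_fun_xsection_finite_kernel (kprobability mk)).
  by rewrite inE.
rewrite [X in measurable X](_ : _ =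
    setT `&` (fun x => k x (xsection A x)) @^-1` [set` `]-oo, lam%:E]]).
  by apply: mP => //; exact: emeasurable_itv.
rewrite setTI; apply/seteqP; split=> x /=;
  rewrite (VaR_le_iff _ lam_gt0 lam_lt1 _ (mfx x) (fun y => bf (x, y))) in_itv/=;
  by rewrite xsectionE.
Qed.

Lemma measurable_AVaR_kernel :
  measurable_fun setT (fun x => AVaR lam (k x) (fun y => f (x, y))).
Proof.
have mV := measurable_VaR_kernel; set v := (X in measurable_fun _ X) in mV.
have E x : AVaR lam (k x) (fun y => f (x, y)) =
    v x + lam^-1 * \int[k x]_y Num.max (f (x, y) - v x) 0.
  exact: (AVaR_def _ lam_gt0 (mfx x) (fun y => bf (x, y))).
rewrite (_ : (fun _ => _) = fun x =>
    v x + lam^-1 * \int[k x]_y Num.max (f (x, y) - v x) 0); last first.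
  by apply/funext => x; exact: E.
apply: measurable_funD => //; apply: measurable_funM => //.
(* The level [v] varies with [x], so the excess is treated as one function of the pair; its bound is
   [M + M] because [v] is bounded by [M]. *)
pose g (z : X * T) := Num.max (f z - v z.1) 0.
apply: (@measurable_Rintegral_kernel g (M + M)).
  apply: measurable_maxr => //; apply: measurable_funB => //.
  exact: measurableT_comp.
move=> [x y]; apply: le_trans (excess_norm (v x) (fun y => bf (x, y)) y) _.
rewrite lerD2l; exact: (VaR_norm _ lam_gt0 lam_lt1 (fun y => bf (x, y))).
Qed.

End kernel_measurability.

(** * Conditional expectation given a sub-sigma-algebra *)

(** Both sides are integrals of [h] against image measures, which coincide. With [phi] the identity
    into a coarser sigma-algebra, this says that measures agreeing there integrate its nonnegative
    measurable functions alike. *)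
Lemma eq_integral_pullback (d d' : measure_display) (T : measurableType d)
    (T' : measurableType d') (R : realType) (phi : T -> T')
    (m1 m2 : {measure set T -> \bar R}) (h : T' -> \bar R) :
  measurable_fun setT phi ->
  (forall A, measurable A -> m1 (phi @^-1` A) = m2 (phi @^-1` A)) ->
  measurable_fun setT h -> (forall z, 0 <= h z)%E ->
  (\int[m1]_w h (phi w) = \int[m2]_w h (phi w))%E.
Proof.
move=> mphi m12 mh h0.
have push (m : {measure set T -> \bar R}) :
    (\int[m]_w h (phi w) = \int[pushforward m phi]_z h z)%E.
  by rewrite ge0_integral_pushforward.
by rewrite !push; apply: eq_measure_integral => A mA _; exact: m12.
Qed.

Section conditional_expectation.
Context d (T : measurableType d) (R : realType) (P : probability T R).
Context (G : set (set T)) (sG : sigma_algebra setT G) (Gm : G `<=` measurable).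
Implicit Types Y Z : T -> R.

Local Notation TG := (g_sigma_algebraType G).

Let measurableG (A : set T) : (@measurable _ TG) A = G A.
Proof. by rewrite /measurable/= sigma_algebra_id. Qed.

Lemma measurable_wrtP Z :
  measurable_wrt G Z <-> measurable_fun (setT : set TG) Z.
Proof.
split=> [mZ _ B mB|mZ B mB]; first by rewrite setTI measurableG; exact: mZ.
by rewrite -measurableG -[X in measurable X]setTI; exact: mZ.
Qed.

Lemma measurable_wrt_fun Z : measurable_wrt G Z -> measurable_fun setT Z.
Proof. by move=> mZ; apply/measurable_wrtE => B mB; exact/Gm/mZ. Qed.

(** The defining identity is tested on the event [Y' < Y], which lies in [G]: the positive function
    [Y - Y'] has integral zero there, so the event is null. *)
Lemma is_condexp_le Z Y Y' : is_condexp P G Z Y -> is_condexp P G Z Y' ->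
  \forall w \ae P, Y w <= Y' w.
Proof.
move=> [mY iY EY] [mY' iY' EY'].
pose A := [set w | 0 < Y w - Y' w].
have GA : G A.
  rewrite -measurableG; apply: (@measurable_superlevel _ TG).
  by apply: measurable_funB; exact/measurable_wrtP.
have mA := Gm GA.
have iYA : P.-integrable A (EFin \o Y) by exact: integrableS iY.
have iYA' : P.-integrable A (EFin \o Y') by exact: integrableS iY'.
have mD : measurable_fun A (fun w => (Y w - Y' w)%:E).
  apply/measurable_EFinP; apply: measurable_funB;
    by apply: measurable_funS (measurable_wrt_fun _).
have : (\int[P]_(w in A) `|(Y w - Y' w)%:E| = 0)%E.
  transitivity (\int[P]_(w in A) ((Y w)%:E - (Y' w)%:E))%E.
    apply: eq_integral => w; rewrite inE => Aw.
    by rewrite gee0_abs// lee_fin ltW.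
  rewrite integralB// EY// EY'// subee// -EY//.
  exact: integrable_fin_num.
move/(ae_eq_integral_abs P mA mD); apply: filterS => w h.
rewrite leNgt; apply/negP => lt; have Aw : A w by rewrite /A/= subr_gt0.
by have := h Aw => -[] /eqP; rewrite subr_eq0 gt_eqF.
Qed.

Lemma is_condexp_unique Z Y Y' : is_condexp P G Z Y -> is_condexp P G Z Y' ->
  \forall w \ae P, Y w = Y' w.
Proof.
move=> cY cY'; have := is_condexp_le cY cY'; have := is_condexp_le cY' cY.
by apply: filterS2 => w h1 h2; apply/eqP; rewrite eq_le h1 h2.
Qed.

Lemma condexpE Z Y : is_condexp P G Z Y ->
  \forall w \ae P, condexp P G Z w = Y w.
Proof.
move=> cY; apply: is_condexp_unique (cY).
by apply: (@xgetPex _ (cst 0) [set Y | is_condexp P G Z Y]); exists Y.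
Qed.

Lemma is_condexp_ae Z Z' Y : measurable_fun setT Z -> measurable_fun setT Z' ->
  (\forall w \ae P, Z w = Z' w) -> is_condexp P G Z Y -> is_condexp P G Z' Y.
Proof.
move=> mZ mZ' ZZ' [mY iY EY]; split=> // A GA; rewrite EY//.
apply: ae_eq_integral; first exact: Gm.
- by apply/measurable_EFinP; exact: measurable_funS mZ.
- by apply/measurable_EFinP; exact: measurable_funS mZ'.
- by apply: filterS ZZ' => w -> _.
Qed.

Lemma is_condexpD_cst Z Y (c : R) : P.-integrable setT (EFin \o Z) ->
  is_condexp P G Z Y -> is_condexp P G (fun w => Z w + c) (fun w => Y w + c).
Proof.
move=> iZ [mY iY EY].
have ic (A : set T) : measurable A -> P.-integrable A (EFin \o cst c).
  by move=> mA; exact: (@bounded_integrable _ _ _ _ _ _ `|c|).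
split.
- apply/measurable_wrtP; apply: measurable_funD => //; exact/measurable_wrtP.
- exact: (integrableD _ iY (ic _ _)).
- move=> A GA; have mA := Gm GA.
  have iYA : P.-integrable A (EFin \o Y) by exact: integrableS iY.
  have iZA : P.-integrable A (EFin \o Z) by exact: integrableS iZ.
  under eq_integral do rewrite EFinD.
  under [RHS]eq_integral do rewrite EFinD.
  by rewrite !integralD// ?EY//; exact: ic.
Qed.

(** A member of [C] that is a.s. below all the others is itself an essential infimum, so the chosen
    version is a genuine one. Its measurability is recorded separately because a.s. equality with
    [v] does not transfer it. *)
Lemma ess_infimum_min (C : set (T -> R)) (v : T -> R) :
  measurable_fun setT v -> C v ->
  (forall c, C c -> \forall w \ae P, v w <= c w) ->
  measurable_fun setT (ess_infimum P C) /\
  \forall w \ae P, ess_infimum P C w = v w.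
Proof.
move=> mv Cv lv.
have iv : is_ess_infimum P C v by split=> // n _; exact.
have [me le ge] : is_ess_infimum P C (ess_infimum P C).
  by apply: (@xgetPex _ (cst 0) [set m | is_ess_infimum P C m]); exists v.
split=> //; have := le _ Cv; have := ge _ mv lv.
by apply: filterS2 => w h1 h2; apply/eqP; rewrite eq_le h1 h2.
Qed.

End conditional_expectation.

(** * Path space *)

Section path_space.
Context (E : ptopologicalType).
Local Notation Om := (path_space E).

(* The paths with the sigma-algebra F_t, so that F_t-measurability becomes
   [measurable_fun] on this type. *)
Definition past (t : nat) := g_sigma_algebraType
  (\bigcup_(s in [set s | (s <= t)%N])
     preimage_set_system setT (fun w : nat -> E => w s : borel E)
       (@measurable _ (borel E))).

Lemma sigma_algebra_filtration t : sigma_algebra setT (@filtration E t).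
Proof. exact: smallest_sigma_algebra. Qed.

Lemma filtration_coord t s (A : set (borel E)) : (s <= t)%N -> measurable A ->
  @filtration E t [set w | A (w s)].
Proof.
by move=> st mA; apply: sub_sigma_algebra; exists s => //; exists A; rewrite ?setTI.
Qed.

Lemma measurable_past_coord t s : (s <= t)%N ->
  measurable_fun (setT : set (past t)) (fun w : past t => w s : borel E).
Proof. by move=> st _ A mA; rewrite setTI; exact: filtration_coord. Qed.

Lemma filtration_mono s t : (s <= t)%N -> @filtration E s `<=` @filtration E t.
Proof.
move=> st; apply: sub_smallest2r; first exact: smallest_sigma_algebra.
by apply: bigcup_subset => r /= /leq_trans; exact.
Qed.

Lemma filtration_measurable t : @filtration E t `<=` (@measurable _ Om).
Proof. by move=> A FA; apply: sub_sigma_algebra; exists t. Qed.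

Lemma measurable_coord s :
  measurable_fun (setT : set Om) (fun w : Om => w s : borel E).
Proof.
move=> _ A mA; rewrite setTI.
exact: filtration_measurable (filtration_coord (leqnn s) mA).
Qed.

Lemma measurable_to_past d (X : measurableType d) (t : nat) (f : X -> past t) :
  (forall s, (s <= t)%N -> measurable_fun setT (fun x => f x s : borel E)) ->
  measurable_fun setT f.
Proof.
move=> mf; apply: measurability; first by reflexivity.
move=> _ [_ [s st [A mA <-]] <-]; rewrite !setTI.
by rewrite -[X in measurable X]setTI; exact: mf.
Qed.

Lemma measurable_to_path d (X : measurableType d) (f : X -> Om) :
  (forall s, measurable_fun setT (fun x => f x s : borel E)) ->
  measurable_fun setT f.
Proof.
move=> mf; apply: measurability; first by reflexivity.
move=> _ [A [t _ FA] <-].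
have : measurable_fun setT (f : X -> past t) by exact: measurable_to_past.
by move=> /(_ measurableT A); exact.
Qed.

(** Composition with this identity turns a function measurable on [past E t] into one measurable for
    the full sigma-algebra. *)
Lemma measurable_id_past t : measurable_fun (setT : set Om) (id : Om -> past t).
Proof. by apply: measurable_to_past => s _; exact: measurable_coord. Qed.

(** At time [t] the value is [w t] and not [w' 0], so the part from time [t] on is a copy of [w']
    only if [w'] starts at [w t]. *)
Definition graft (t : nat) (w w' : Om) : Om :=
  fun s => if (s <= t)%N then w s else w' (s - t)%N.

Lemma graft_past t w w' s : (s <= t)%N -> graft t w w' s = w s.
Proof. by rewrite /graft => ->. Qed.

Lemma graft_future t w w' s : w' 0%N = w t -> graft t w w' (t + s)%N = w' s.
Proof.
move=> w0; rewrite /graft; case: ifPn; last by rewrite addKn.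
by rewrite -{2}[t]addn0 leq_add2l leqn0 => /eqP ->; rewrite addn0 w0.
Qed.

(** Whatever is computed from [graft t w] is therefore unchanged when [w] is replaced by a graft of
    itself at time [t]. *)
Lemma graftK t w w' w'' : graft t (graft t w w') w'' = graft t w w''.
Proof. by apply/funext => s; rewrite /graft; case: ifP => // ->. Qed.

(** The first factor carries only F_t, since [graft] reads [w] up to time [t]. Kernel integrals over
    the second factor thus come out F_t-measurable. *)
Lemma measurable_graft t :
  measurable_fun (setT : set (past t * Om))
    (fun z : past t * Om => graft t z.1 z.2).
Proof.
apply: measurable_to_path => s; rewrite /graft.
case: (boolP (s <= t)%N) => st.
  exact: (measurableT_comp (measurable_past_coord st) measurable_fst).
exact: (measurableT_comp (measurable_coord (s - t)) measurable_snd).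
Qed.

Lemma measurable_graft2 t w : measurable_fun (setT : set Om) (graft t w).
Proof.
by have := measurable_fun_pair2 (w : past t) (@measurable_graft t); exact.
Qed.

(** Beyond [t] and up to [n] the grafted path shows the coordinates of the second path up to
    [n - t]; hence events of F_n pull back to events of F_(n-t), as the induction on [n]
    requires. *)
Lemma measurable_graft_past t n w : (t <= n)%N ->
  measurable_fun (setT : set (past (n - t)))
    (graft t w : past (n - t) -> past n).
Proof.
move=> tn; apply: measurable_to_past => s sn; rewrite /graft.
case: (boolP (s <= t)%N) => st; first exact: measurable_cst.
by apply: measurable_past_coord; rewrite leq_sub2r.
Qed.

(** The sets that depend only on the path up to time [t] form a sigma-algebra containing the
    generators of F_t. *)
Lemma filtration_agree t (A : set (nat -> E)) w w' : @filtration E t A ->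
  (forall s, (s <= t)%N -> w s = w' s) -> A w -> A w'.
Proof.
move=> FA ww'; pose H := [set A : set (nat -> E) |
  forall v v', (forall s, (s <= t)%N -> v s = v' s) -> A v <-> A v'].
suff h : H A by apply: (h w w' ww').1.
apply: FA; split; last first.
  by move=> _ [s st [B _ <-]] v v' vv'; rewrite setTI /= vv'.
split=> //.
- by move=> B hB v v' vv'; split=> -[_ h]; split=> // Bv; apply: h;
    apply/(hB _ _ vv').
- by move=> F hF v v' vv'; split=> -[n _ Fn]; exists n => //; apply/(hF n _ _ vv').
Qed.

Lemma filtration_graft t A w w' : @filtration E t A -> A (graft t w w') = A w.
Proof.
move=> FA; apply/propext; split; apply: filtration_agree FA _ => s st;
  by rewrite graft_past.
Qed.

(** The fibre of [Y] through [w] is an event of F_t, hence stable under grafting. The equality holds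
    for all paths, which is what makes the conditional objects pathwise. *)
Lemma measurable_wrt_graft (R : realType) t (Y : Om -> R) w w' :
  measurable_wrt (@filtration E t) Y -> Y (graft t w w') = Y w.
Proof.
move=> /(_ _ (measurable_set1 (Y w))) FA.
by have := filtration_graft w w' FA; rewrite /preimage/= => ->.
Qed.

Lemma measurable_shift t : measurable_fun (setT : set Om) (@time_shift E t).
Proof. by apply: measurable_to_path => s; exact: measurable_coord. Qed.

End path_space.

(** The complement of the point is open: the ball around [y] of radius [d y x] misses [x]. This
    makes starting at [x] an event on path space. *)
Lemma polish_measurable_set1 (R : realType) (E : ptopologicalType) (x : E) :
  polish_space R E -> measurable ([set x] : set (borel E)).
Proof.
move=> [_ [d [d0 dC dT nbhsE _]]].
have dge y z : 0 <= d y z.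
  by have := dT y z y; rewrite (dC z y) (d0 y y).2//; lra.
rewrite -[X in measurable X]setCK; apply: measurableC; apply: sub_sigma_algebra.
rewrite openE => y /= /eqP yx; apply/nbhsE.
exists (d y x).
  rewrite lt_neqAle dge andbT eq_sym.
  by apply/eqP => /d0/eqP; rewrite (negbTE yx).
by move=> z /= + zx; rewrite zx ltxx.
Qed.

(** * Markov property *)

Section markov_kernel.
Context (R : realType) (E : ptopologicalType) (polishE : polish_space R E).
Context (P : E -> probability (path_space E) R) (chainP : markov_chain P).
Local Notation Om := (path_space E).

Lemma start_ae x (H : Om -> Prop) : (forall w, w 0%N = x -> H w) ->
  \forall w \ae P x, H w.
Proof.
move=> xH.
case: chainP => _ + _ => /(_ x) Px.
have mA : measurable [set w : Om | w 0%N = x].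
  apply: filtration_measurable.
  exact: (filtration_coord (leqnn 0) (polish_measurable_set1 x polishE)).
exists (~` [set w : Om | w 0%N = x]); split; first exact: measurableC.
  by have := @probability_setC _ _ _ (P x) _ mA; rewrite Px subee//; exact.
by move=> w /= nHw w0; apply: nHw; exact: xH.
Qed.

Lemma measurable_kernel_at t :
  measurable_fun (setT : set (past E t))
    ((fun w => P (w t)) : past E t -> pprobability Om R).
Proof.
case: chainP => mP _ _.
exact: (measurableT_comp mP (measurable_past_coord (leqnn t))).
Qed.

(** The kernel K_t(w, .), typed in the Giry monad so that it can be bound to [P x]. *)
Definition regraft (t : nat) (w : Om) : giry Om R :=
  giry_map (measurable_graft2 t w) (P (w t)).

Lemma measurable_regraft_past t :
  measurable_fun (setT : set (past E t)) (regraft t : past E t -> giry Om R).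
Proof.
apply: measurable_giry_codensity => // B mB.
pose A := (fun z : past E t * Om => graft t z.1 z.2) @^-1` B.
have mA : measurable A.
  by rewrite -[A]setTI; exact: measurable_graft.
have := measurable_fun_xsection_finite_kernel
  (kprobability (@measurable_kernel_at t)) (mem_set mA).
congr measurable_fun; apply/funext => w; congr (P _ _).
by apply/seteqP; split=> w' /=; rewrite /xsection/= inE.
Qed.

Lemma measurable_regraft t : measurable_fun setT (regraft t).
Proof.
exact: (measurableT_comp (@measurable_regraft_past t) (@measurable_id_past E t)).
Qed.

Lemma int_regraft t w (h : Om -> \bar R) :
  measurable_fun setT h -> (forall v, 0 <= h v)%E ->
  (\int[regraft t w]_v h v = \int[P (w t)]_v h (graft t w v))%E.
Proof. by move=> mh h0; exact: (giry_int_map (measurable_graft2 t w)). Qed.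

Let p (A : set (borel E)) (z : E) : R := fine (P z [set w | A (w 1%N)]).

Let p_ge0 A z : 0 <= p A z.
Proof. by rewrite fine_ge0. Qed.

Let measurable_step n (B : set Om) (A : set (borel E)) :
  filtration n B -> measurable A ->
  measurable_fun (setT : set (past E n)) (fun w => \1_B w * p A (w n)).
Proof.
(* Measurability of the transition probability at time [n] does not involve the initial state, so
   the Markov clause is read off at an arbitrary one. *)
move=> FB mA; have [mp _ _] : is_condexp (P point) (@filtration E n)
    (\1_[set w : Om | A (w n.+1)]) (fun w => p A (w n)).
  by case: chainP => _ _; exact.
apply: measurable_funM; first exact: measurable_indic.
by move=> _ C mC; rewrite setTI; exact: mp.
Qed.

(** The one-step Markov property integrated over an event of F_n. The initial state is free because
    it is used under both [P x] and [P (w t)]. *)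
Let one_step y n (B : set Om) (A : set (borel E)) :
  filtration n B -> measurable A ->
  (\int[P y]_w (\1_B w * p A (w n))%:E =
   P y (B `&` [set w | A (w n.+1)]))%E.
Proof.
move=> FB mA; case: chainP => _ _ /(_ y n A mA) [_ _ /(_ B FB)].
have mB : measurable B by exact: filtration_measurable FB.
have mC : measurable [set w : Om | A (w n.+1)].
  exact: filtration_measurable (filtration_coord (leqnn _) mA).
rewrite integral_indic// setIC => <-.
rewrite [RHS]integral_mkcond; apply: eq_integral => w _.
by rewrite /patch indicE; case: (w \in B); rewrite ?mul1r ?mul0r.
Qed.

(** The mixture of the K_t(w, .) under [P x], to be identified with [P x] itself. *)
Let Q x t : giry Om R := giry_bind (P x : subprobability Om R) (measurable_regraft t).

Let int_Q x t (h : Om -> \bar R) :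
  measurable_fun setT h -> (forall v, 0 <= h v)%E ->
  (\int[Q x t]_v h v = \int[P x]_w \int[P (w t)]_v h (graft t w v))%E.
Proof.
move=> mh h0.
have := giry_int_bind (P x : subprobability Om R) (measurable_regraft t) mh h0.
rewrite /giry_int => ->; apply: eq_integral => w _; exact: int_regraft.
Qed.

Let QE x t (B : set Om) : measurable B ->
  Q x t B = (\int[P x]_w P (w t) (graft t w @^-1` B))%E.
Proof.
move=> mB; transitivity (\int[Q x t]_v (\1_B v)%:E)%E.
  by rewrite integral_indic// setIT.
rewrite int_Q//; last by apply/measurable_EFinP; exact: measurable_indic.
apply: eq_integral => w _.
have mB' : measurable (graft t w @^-1` B).
  by rewrite -[X in measurable X]setTI; exact: measurable_graft2.
by rewrite -[in RHS](setIT (graft t w @^-1` B)) -integral_indic.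
Qed.

(** An event of F_t is decided by [w] alone, so K_t(w, B) is the indicator of [B] at [w]. *)
Let Q_past x t B : filtration t B -> Q x t B = P x B.
Proof.
move=> FB; have mB := filtration_measurable FB.
rewrite QE// -[in RHS](setIT B) -integral_indic//.
apply: eq_integral => w _; rewrite indicE.
have -> : graft t w @^-1` B = if w \in B then setT else set0.
  apply/seteqP; rewrite /preimage; split=> v /=; rewrite filtration_graft//;
    by case: ifPn; rewrite ?notin_setE ?inE.
by case: ifP; rewrite ?probability_setT ?measure0.
Qed.

Let Q_step x t n : (t <= n)%N ->
  (forall B, filtration n B -> Q x t B = P x B) ->
  (forall B, filtration n.+1 B -> Q x t B = P x B).
Proof.
move=> tn IH.
(* These sets form a pi-system that generates F_(n+1), so it suffices to compare the two measures on
   them. *)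
pose G := [set B `&` [set w : Om | A (w n.+1)] |
  B in @filtration E n & A in (@measurable _ (borel E))].
have FS : @filtration E n.+1 `<=` <<s G >>.
  apply: smallest_sub; first exact: smallest_sigma_algebra.
  move=> _ [s sn [A mA <-]]; apply: sub_sigma_algebra; rewrite setTI.
  move: sn; rewrite /= leq_eqVlt => /predU1P[->|sn].
    by exists setT; [exact: (@measurableT _ (past E n))|exists A; rewrite ?setTI].
  exists [set w | A (w s)]; first exact: filtration_coord.
  by exists setT => //; rewrite setIT.
have mC (A : set (borel E)) : measurable A -> measurable [set w : Om | A (w n.+1)].
  by move=> mA; exact: filtration_measurable (filtration_coord (leqnn _) mA).
move=> B /FS; move: B.
apply: (@g_sigma_algebra_measure_unique _ R Om G _ (fun=> setT) _ _
  (Q x t) (P x)).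
- move=> _ [B' FB' [A mA <-]]; apply: measurableI; last exact: mC.
  exact: filtration_measurable FB'.
- by move=> _; exists setT; [exact: (@measurableT _ (past E n))|
    exists setT; rewrite ?setTI].
- by rewrite bigcup_const.
- move=> _ _ [B1 F1 [A1 mA1 <-]] [B2 F2 [A2 mA2 <-]].
  exists (B1 `&` B2); first exact: (@measurableI _ (past E n)).
  by exists (A1 `&` A2); [exact: measurableI|rewrite setIACA].
- move=> _ [{}B FB [A mA <-]].
  have mB := filtration_measurable FB.
  pose h w := (\1_B w * p A (w n))%:E.
  have h0 w : (0 <= h w)%E by rewrite lee_fin mulr_ge0.
  have mh : measurable_fun (setT : set (past E n)) h.
    by apply/measurable_EFinP; exact: measurable_step.
  have mh' : measurable_fun (setT : set Om) (h : Om -> \bar R).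
    exact: (measurableT_comp mh (@measurable_id_past E n)).
  rewrite -[LHS]/(Q x t _) QE; last by apply: measurableI => //; exact: mC.
  transitivity (\int[P x]_w \int[P (w t)]_v h (graft t w v))%E.
    apply: eq_integral => w _.
    have FB' : filtration (n - t) (graft t w @^-1` B).
      by rewrite -[X in filtration _ X]setTI; exact: (measurable_graft_past w tn).
    (* Coordinate [n.+1] of the grafted path is coordinate [(n - t).+1] of [v], so the one-step
       property under [P (w t)] is applied at time [n - t]. *)
    rewrite (_ : _ @^-1` _ = graft t w @^-1` B `&` [set v | A (v (n - t).+1)]).
      rewrite -one_step//; apply: ge0_ae_eq_integral => //.
      + apply/measurable_EFinP.
        exact: (measurableT_comp (measurable_step FB' mA) (@measurable_id_past E _)).
      + exact: (measurableT_comp mh' (measurable_graft2 t w)).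
      + by move=> v _; rewrite lee_fin mulr_ge0.
      (* The a.s. equality [v 0 = w t] matters when [n = t], where the graft shows [w t] in place of
         [v 0]. *)
      + by apply: start_ae => v v0 _; rewrite /h -{2}(subnKC tn) graft_future.
    apply/seteqP; split=> v /=; rewrite /graft leqNgt ltnS tn /= subSn//.
  (* What remains is the integral of the F_n-measurable [h] under [Q x t] and under [P x], which
     agree by the induction hypothesis. *)
  rewrite -int_Q// -[RHS]/(P x _) -one_step//.
  by apply: (eq_integral_pullback (@measurable_id_past E n)).
- by move=> _; rewrite (le_lt_trans sprobability_setT)// ltry.
Qed.

(** Agreement on each F_n comes from [Q_past] for [n] up to [t] and from [Q_step] beyond; the union
    of the F_n is a pi-system generating the full sigma-algebra. *)
Lemma regraft_invariant x t B : measurable B ->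
  (\int[P x]_w P (w t) (graft t w @^-1` B) = P x B)%E.
Proof.
move=> mB; rewrite -QE//.
have QF n : forall C, filtration n C -> Q x t C = P x C.
  elim: n => [|n IH].
    by move=> C FC; apply: Q_past; exact: filtration_mono FC.
  have [nt|tn] := ltnP n t.
    by move=> C FC; apply: Q_past; exact: filtration_mono FC.
  exact: Q_step.
move: B mB; apply: (@g_sigma_algebra_measure_unique _ R Om
  (\bigcup_s @filtration E s) _ (fun=> setT) _ _ (Q x t) (P x)).
- by move=> C FC; exact: sub_sigma_algebra.
- by move=> _; exists 0%N => //; exact: (@measurableT _ (past E 0)).
- by rewrite bigcup_const.
- move=> C D [m _ FC] [n _ FD]; exists (maxn m n) => //.
  apply: (@measurableI _ (past E (maxn m n))).
    exact: (filtration_mono (leq_maxl m n)).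
  exact: (filtration_mono (leq_maxr m n)).
- by move=> C [n _]; exact: QF.
- by move=> _; rewrite (le_lt_trans sprobability_setT)// ltry.
Qed.

Lemma integral_graft x t (h : Om -> \bar R) :
  measurable_fun setT h -> (forall v, 0 <= h v)%E ->
  (\int[P x]_w \int[P (w t)]_v h (graft t w v) = \int[P x]_v h v)%E.
Proof.
move=> mh h0; rewrite -int_Q//; apply: eq_measure_integral => A mA _.
by rewrite -[RHS]/(P x A) -(regraft_invariant x t mA) -QE.
Qed.

End markov_kernel.

(** * Conditional value at risk of the chain *)

Lemma norm_Rintegral_le d (T : measurableType d) (R : realType)
    (P : probability T R) (Z : T -> R) (M : R) :
  measurable_fun setT Z -> (forall w, `|Z w| <= M) ->
  `|\int[P]_w Z w| <= M.
Proof.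
move=> mZ bZ.
have iZ : P.-integrable setT (EFin \o Z) by exact: bounded_integrable bZ.
have ic (c : R) : P.-integrable setT (EFin \o cst c).
  by exact: (@bounded_integrable _ _ _ _ _ _ `|c|).
rewrite ler_norml -{1}(Rintegral_probability_cst P (- M)).
rewrite -{2}(Rintegral_probability_cst P M); apply/andP; split;
  apply: le_Rintegral => //; try exact: ic;
  by move=> w _; have := bZ w; rewrite ler_norml => /andP[].
Qed.

Lemma bounded_rvP d (T : measurableType d) (R : realType) (Z : T -> R) :
  bounded_rv measurable Z <->
  measurable_fun setT Z /\ exists M, forall w, `|Z w| <= M.
Proof.
by split=> -[/measurable_wrtE mZ /bounded_fun_ubP bZ]; split=> //.
Qed.

Section conditional_law.
Context (R : realType) (E : ptopologicalType) (polishE : polish_space R E).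
Context (P : E -> probability (path_space E) R) (chainP : markov_chain P).
Local Notation Om := (path_space E).
Implicit Types Z : Om -> R.

Let F t : set (set Om) := @filtration E t.

Let sF t : sigma_algebra setT (F t).
Proof. exact: sigma_algebra_filtration. Qed.

Let Fm t : F t `<=` measurable.
Proof. exact: filtration_measurable. Qed.

Lemma past_measurable_wrt t (Y : Om -> R) :
  measurable_fun (setT : set (past E t)) (Y : past E t -> R) ->
  measurable_wrt (@filtration E t) Y.
Proof. by move=> mY B mB; rewrite -[X in filtration _ X]setTI; exact: mY. Qed.

Let wrt_measurable t (Y : Om -> R) :
  measurable_wrt (@filtration E t) Y -> measurable_fun setT Y.
Proof. by move=> mY; apply/measurable_wrtE => B mB; apply: (@Fm t); exact: mY. Qed.

Lemma measurable_graft_comp t w Z : measurable_fun setT Z ->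
  measurable_fun setT (Z \o graft t w).
Proof. by move=> mZ; exact: (measurableT_comp mZ (measurable_graft2 t w)). Qed.

Let measurable_graft_joint t Z : measurable_fun setT Z ->
  measurable_fun (setT : set (past E t * Om))
    (fun z : past E t * Om => Z (graft t z.1 z.2)).
Proof. by move=> mZ; exact: (measurableT_comp mZ (@measurable_graft E t)). Qed.

Lemma is_condexp_graft x t Z (M : R) :
  measurable_fun setT Z -> (forall w, `|Z w| <= M) ->
  is_condexp (P x) (@filtration E t) Z
    (fun w => \int[P (w t)]_v Z (graft t w v)).
Proof.
(* Nonnegative losses come first, so that [integral_graft] applies to the loss restricted to [A];
   grafting preserves membership in [A], so the restriction leaves the inner integral. *)
have key Z' M' : measurable_fun setT Z' -> (forall w, `|Z' w| <= M') ->
    (forall w, 0 <= Z' w) -> is_condexp (P x) (@filtration E t) Z'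
    (fun w => \int[P (w t)]_v Z' (graft t w v)).
  move=> {}mZ {}bZ Z0.
  have mY : measurable_wrt (@filtration E t)
      (fun w : Om => \int[P (w t)]_v Z' (graft t w v)).
    apply: past_measurable_wrt.
    have := measurable_Rintegral_kernel (@measurable_kernel_at _ _ _ chainP t)
      (measurable_graft_joint mZ) (fun z => bZ (graft t z.1 z.2)).
    exact.
  split=> //.
  - apply: (@bounded_integrable _ _ _ _ _ _ M') => //.
      exact: (@wrt_measurable t _ mY).
    move=> w; apply: norm_Rintegral_le => //.
    exact: (measurable_graft_comp t w mZ).
  - move=> A FA; have mA := filtration_measurable FA.
    rewrite integral_mkcond [RHS]integral_mkcond.
    have m1 : measurable_fun setT (((fun w => (Z' w)%:E) \_ A) : Om -> \bar R).
      apply/(measurable_restrictT _ mA)/measurable_EFinP.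
      exact: measurable_funS mZ.
    rewrite -(integral_graft polishE chainP x t m1); last first.
      by move=> v; rewrite /patch; case: ifP => // _; rewrite lee_fin.
    apply: eq_integral => w _; rewrite {1}/patch; case: ifPn => wA.
      rewrite inE in wA; rewrite /Rintegral fineK.
        apply: eq_integral => v _; rewrite /patch.
        by rewrite mem_set// filtration_graft.
      apply: integrable_fin_num => //.
      exact: (bounded_integrable _ _ (measurable_graft_comp t w mZ) (fun v => bZ _)).
    rewrite notin_setE in wA; rewrite integral0_eq// => v _.
    by rewrite /patch memNset// filtration_graft.
move=> mZ bZ.
have M0 w : 0 <= Z w + M by have := bZ w; rewrite ler_norml; lra.
have mZM : measurable_fun setT (fun w => Z w + M) by exact: measurable_funD.
have bZM w : `|Z w + M| <= M + `|M| by rewrite (le_trans (ler_normD _ _))// lerD2r.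
have := is_condexpD_cst (sF t) (@Fm t) (- M)
  (bounded_integrable (P x) measurableT mZM bZM) (key _ _ mZM bZM M0).
congr is_condexp; apply/funext => w; first by rewrite addrK.
rewrite RintegralD//.
- by rewrite Rintegral_probability_cst addrK.
- exact: (bounded_integrable _ _ (measurable_graft_comp t w mZ) (fun v => bZ _)).
- exact: (@bounded_integrable _ _ _ _ _ _ `|M|).
Qed.

(** A null set [N] of [P x] satisfies: the integral of K_t(w, N) under [P x] is zero, so [N] is null
    for K_t(w, .) for almost every [w]. *)
Lemma ae_graft x t (A : Om -> Prop) : (\forall w \ae P x, A w) ->
  \forall w \ae P x, \forall v \ae P (w t), A (graft t w v).
Proof.
move=> [N [mN N0 sN]].
have mk : measurable_fun (setT : set Om)
    (fun w : Om => P (w t) (graft t w @^-1` N)).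
  exact: (measurableT_comp (measurable_giry_ev mN) (measurable_regraft chainP t)).
have : (\int[P x]_w `|P (w t) (graft t w @^-1` N)| = 0)%E.
  rewrite -N0 -[RHS]/(P x N) -(regraft_invariant polishE chainP x t mN).
  by apply: eq_integral => w _; rewrite gee0_abs.
move/(ae_eq_integral_abs (P x) measurableT mk); apply: filterS => w /(_ I) Nw.
exists (graft t w @^-1` N); split => //.
  by rewrite -[X in measurable X]setTI; exact: measurable_graft2.
by move=> v /= /sN.
Qed.

Context (lam : R) (lam_gt0 : 0 < lam) (lam_lt1 : lam < 1).

Let V t Z (w : Om) := VaR lam (P (w t)) (Z \o graft t w).

(** Under [P (w t)] the variable [Z \o graft t w] has the law of [Z] under K_t(w, .), so this is the
    average value at risk of [Z] under K_t(w, .). *)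
Definition graft_AVaR t Z (w : Om) : R := AVaR lam (P (w t)) (Z \o graft t w).

Let V_graft t Z w v : V t Z (graft t w v) = V t Z w.
Proof.
rewrite /V graft_past//; congr VaR; apply/funext => u /=; by rewrite graftK.
Qed.

Section bounded_loss.
Context (Z : Om -> R) (M : R) (mZ : measurable_fun setT Z)
  (bZ : forall w, `|Z w| <= M).

Let bounded_V t : bounded_rv (@filtration E t) (V t Z).
Proof.
split; last first.
  apply/bounded_fun_ubP; exists M => w.
  by apply: (VaR_norm _ lam_gt0 lam_lt1) => v; exact: bZ.
apply: past_measurable_wrt.
have := measurable_VaR_kernel (@measurable_kernel_at _ _ _ chainP t)
  lam_gt0 lam_lt1 (measurable_graft_joint mZ) (fun z => bZ (graft t z.1 z.2)).
exact.
Qed.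

Lemma bounded_graft_AVaR t : bounded_rv (@filtration E t) (graft_AVaR t Z).
Proof.
split; last first.
  apply/bounded_fun_ubP; exists M => w.
  apply: (AVaR_norm _ lam_gt0 lam_lt1); first exact: measurable_graft_comp.
  by move=> v; exact: bZ.
apply: (@past_measurable_wrt t (graft_AVaR t Z)).
have := measurable_AVaR_kernel (@measurable_kernel_at _ _ _ chainP t)
  lam_gt0 lam_lt1 (measurable_graft_joint mZ) (fun z => bZ (graft t z.1 z.2)).
exact.
Qed.

(** As [m] is unchanged by grafting, the conditional probability of [m < Z] at [w] is the K_t(w,
    .)-mass of the event that [Z] exceeds the number [m w]; [VaR_le_iff] then applies for each [w].
    So [V t Z] is the a.s. least admissible level. *)
Let cond_level x t (m : Om -> R) : bounded_rv (@filtration E t) m ->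
  (\forall w \ae P x,
     condexp (P x) (@filtration E t) (\1_[set w | m w < Z w]) w <= lam) <->
  (\forall w \ae P x, V t Z w <= m w).
Proof.
move=> [mm _]; set A := [set w | m w < Z w].
have mA : measurable A.
  have -> : A = [set w | 0 < Z w - m w].
    by apply/seteqP; split=> w /=; rewrite subr_gt0.
  apply: measurable_superlevel; apply: measurable_funB => //.
  exact: (@wrt_measurable t _ mm).
have b1 (w : Om) : `|\1_A w : R| <= 1.
  by rewrite indicE; case: (w \in A); rewrite ?normr1 ?normr0.
have mI : measurable_fun setT (\1_A : Om -> R) by exact: measurable_indic.
have ce := condexpE (sF t) (@Fm t) (is_condexp_graft x t mI b1).
have lev w : (\int[P (w t)]_v \1_A (graft t w v) <= lam) = (V t Z w <= m w).
  rewrite (VaR_le_iff _ lam_gt0 lam_lt1 _ (measurable_graft_comp t w mZ)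
    (fun v => bZ _)).
  have -> : [set v | m w < (Z \o graft t w) v] = graft t w @^-1` A.
    apply/seteqP; rewrite /preimage /A; split=> v /=;
      by rewrite (measurable_wrt_graft w v mm).
  have mA' : measurable (graft t w @^-1` A).
    by rewrite -[X in measurable X]setTI; exact: measurable_graft2.
  rewrite -[X in (X <= _)%E]fineK ?lee_fin ?fin_num_measure//.
  rewrite /Rintegral -[in RHS](setIT (graft t w @^-1` A)) -integral_indic//.
by split; apply: filterS2 ce => w -> ; rewrite lev.
Qed.

Lemma cond_VaR_graft x t :
  measurable_fun setT (cond_VaR lam (P x) (@filtration E t) Z) /\
  \forall w \ae P x, cond_VaR lam (P x) (@filtration E t) Z w = V t Z w.
Proof.
apply: (ess_infimum_min (P := P x) (v := V t Z)).
- exact: (@wrt_measurable t _ (bounded_V t).1).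
- split; first exact: bounded_V.
  by apply/(cond_level _ (bounded_V t)); exact: aeW.
- by move=> m [bm /(cond_level _ bm)].
Qed.

Lemma cond_AVaR_graft x t :
  \forall w \ae P x, cond_AVaR lam (P x) (@filtration E t) Z w = graft_AVaR t Z w.
Proof.
have [mc cV] := cond_VaR_graft x t.
have mV := @wrt_measurable t _ (bounded_V t).1.
pose g v (w : Om) := v w + lam^-1 * Num.max (Z w - v w) 0.
have mg v : measurable_fun setT v -> measurable_fun setT (g v).
  move=> mv; apply: measurable_funD => //; apply: measurable_funM => //.
  by apply: measurable_maxr => //; exact: measurable_funB.
have VM w : `|V t Z w| <= M.
  by apply: (VaR_norm _ lam_gt0 lam_lt1) => v; exact: bZ.
have bg w : `|g (V t Z) w| <= M + lam^-1 * (M + M).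
  rewrite (le_trans (ler_normD _ _))// lerD// normrM gtr0_norm ?invr_gt0//.
  rewrite ler_pM2l ?invr_gt0//.
  by apply: le_trans (excess_norm (V t Z w) bZ w) _; rewrite lerD2l.
(* The chosen version of the conditional value at risk is first replaced by [V t Z] inside the
   integrand; as [V t Z] is unchanged by grafting, the kernel integral is then the defining formula
   of [AVaR] under [P (w t)]. *)
have := condexpE (sF t) (@Fm t)
  (is_condexp_ae (@Fm t) (mg _ mV) (mg _ mc) _ (is_condexp_graft x t (mg _ mV) bg)).
have gV : \forall w \ae P x,
    g (V t Z) w = g (cond_VaR lam (P x) (@filtration E t) Z) w.
  by apply: filterS cV => w; rewrite /g => ->.
move=> /(_ gV); apply: filterS => w; rewrite -/(cond_AVaR _ _ _ _) => ->.
rewrite /graft_AVaR /AVaR unlock; apply: eq_Rintegral => v _.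
by rewrite /g V_graft.
Qed.

End bounded_loss.
End conditional_law.

(** * The average value at risk family: existence, risk mapping axioms and Markov property *)

Section AVaR_family_markovian.
Context (R : realType) (E : ptopologicalType) (polishE : polish_space R E).
Context (P : E -> probability (path_space E) R) (chainP : markov_chain P).
Context (lam : R) (lam_gt0 : 0 < lam) (lam_lt1 : lam < 1).
Local Notation Om := (path_space E).
Local Notation bF := (@bounded_rv Om R measurable).
Implicit Types Z : Om -> R.

Lemma AVaR_family_exists :
  exists rho : E -> dynamic_mapping (path_space E) R, AVaR_family lam P rho.
Proof.
(* The pathwise version is bounded and F_t-measurable everywhere; [rho_succ] at [s] is the mapping
   at time [s.+1]. *)
exists (fun x => DynamicMapping (fun Z => AVaR lam (P x) Z)
  (fun s Z => graft_AVaR P lam s.+1 Z)); split=> // x [//|t] Z _.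
move=> /bounded_rvP[mZ [M bZ]]; split=> /=.
  exact: (bounded_graft_AVaR chainP lam_gt0 lam_lt1 mZ bZ).
have := cond_AVaR_graft polishE chainP lam_gt0 lam_lt1 mZ bZ x t.+1.
by apply: filterS => w ->.
Qed.

Lemma risk_mapping_AVaR x (rho : (Om -> R) -> R) :
  (forall Z, bF Z -> rho Z = AVaR lam (P x) Z) -> risk_mapping (P x) rho.
Proof.
move=> rhoE; split.
- rewrite rhoE ?AVaR0//; apply/bounded_rvP; split=> //.
  by exists 0 => w; rewrite normr0.
- move=> Z c bZ; move/bounded_rvP: (bZ) => [mZ [M ZM]].
  rewrite !rhoE//; first exact: (AVaR_translate _ lam_gt0 lam_lt1 _ mZ ZM).
  apply/bounded_rvP; split; first exact: measurable_funD.
  by exists (M + `|c|) => w; rewrite (le_trans (ler_normD _ _))// lerD2r.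
- move=> Z Z' bZ bZ' ZZ'; rewrite !rhoE//.
  move/bounded_rvP: bZ => [mZ [M ZM]]; move/bounded_rvP: bZ' => [mZ' [M' ZM']].
  exact: (AVaR_mono lam_gt0 lam_lt1 mZ ZM mZ' ZM' ZZ').
Qed.

Lemma cond_risk_mapping_AVaR x t (rho : (Om -> R) -> (Om -> R)) :
  (forall Z, bF Z -> bounded_rv (@filtration E t) (rho Z)) ->
  (forall Z, bF Z -> \forall w \ae P x, rho Z w = graft_AVaR P lam t Z w) ->
  cond_risk_mapping (P x) (@filtration E t) rho.
Proof.
move=> bdd rhoE; split=> //.
- have b0 : bF (cst 0).
    by apply/bounded_rvP; split=> //; exists 0 => w; rewrite normr0.
  apply: filterS (rhoE _ b0) => w ->.
  rewrite /graft_AVaR (_ : cst 0 \o _ = cst 0) ?AVaR0//.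
- move=> Z Z' bZ [mZ' bdZ']; have /bounded_rvP [mZ [M ZM]] := bZ.
  have [M' ZM'] := (bounded_fun_ubP _).1 bdZ'.
  have mZ'F : measurable_fun setT Z'.
    by apply/measurable_wrtE => B mB; apply: filtration_measurable; exact: mZ'.
  have bZZ' : bF (fun u => Z u + Z' u).
    apply/bounded_rvP; split; first exact: measurable_funD.
    by exists (M + M') => w; rewrite (le_trans (ler_normD _ _))// lerD.
  apply: filterS2 (rhoE _ bZ) (rhoE _ bZZ') => w -> ->.
  (* Along grafts of [w] the variable [Z'] is the constant [Z' w], so this is translation by a
     number. *)
  rewrite /graft_AVaR -(@AVaR_translate _ _ _ _ _ lam_gt0 lam_lt1 _ M).
  + congr AVaR; apply/funext => v /=; congr (_ + _).
    exact: measurable_wrt_graft.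
  + exact: measurable_graft_comp.
  + by move=> v; exact: ZM.
- move=> Z Z' bZ bZ' ZZ'; have /bounded_rvP [mZ [M ZM]] := bZ.
  have /bounded_rvP [mZ' [M' ZM']] := bZ'.
  have := ae_graft polishE chainP t ZZ'.
  apply: filterS3 (rhoE _ bZ) (rhoE _ bZ') => w -> -> ZZ'w.
  apply: (AVaR_mono lam_gt0 lam_lt1 _ (fun v => ZM _) _ (fun v => ZM' _) ZZ'w);
    exact: measurable_graft_comp.
Qed.

(** Valid for every [w]: the exceptional paths are those not starting at [w t], null for [P (w t)],
    and [AVaR] ignores them. *)
Lemma graft_AVaR_shift t Z w : bF Z ->
  graft_AVaR P lam t (Z \o @time_shift E t) w = AVaR lam (P (w t)) Z.
Proof.
move=> /bounded_rvP [mZ [M ZM]].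
apply: (eq_AVaR lam_gt0 lam_lt1 _ (fun v => ZM _) mZ ZM).
  apply: (@measurable_graft_comp _ _ t w (Z \o @time_shift E t)).
  exact: (measurableT_comp mZ (@measurable_shift E t)).
apply: (start_ae polishE chainP) => v v0 /=.
by congr Z; apply/funext => s; rewrite /time_shift graft_future.
Qed.

Lemma regular_AVaR (rho : E -> dynamic_mapping Om R) :
  (forall x Z, bF Z -> rho_zero (rho x) Z = AVaR lam (P x) Z) -> regular rho.
Proof.
move=> rhoE Z bZ; have /bounded_rvP [mZ [M ZM]] := bZ.
have -> : (fun x => rho_zero (rho x) Z) = (fun x => AVaR lam (P x) Z).
  by apply/funext => x; exact: rhoE.
split.
  by apply/bounded_fun_ubP; exists M => x; exact: (AVaR_norm _ lam_gt0 lam_lt1).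
case: chainP => mP _ _.
(* [Z] is viewed as a function of the pair constant in the state, with [P] as the kernel. *)
have mZ2 : measurable_fun (setT : set (borel E * Om)) (Z \o snd).
  exact: (measurableT_comp mZ measurable_snd).
exact: (measurable_AVaR_kernel mP lam_gt0 lam_lt1 mZ2 (fun z => ZM z.2)).
Qed.

Lemma AVaR_family_markovian (rho : E -> dynamic_mapping Om R) :
  AVaR_family lam P rho -> markovian P rho.
Proof.
move=> [rho0 rhoS].
have rhoE x t Z : (0 < t)%N -> bF Z ->
    \forall w \ae P x, rho_at (rho x) t Z w = graft_AVaR P lam t Z w.
  move=> t0 bZ; have [_ h] := rhoS x t Z t0 bZ.
  have /bounded_rvP [mZ [M ZM]] := bZ.
  have := cond_AVaR_graft polishE chainP lam_gt0 lam_lt1 mZ ZM x t.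
  by apply: filterS2 h => w -> ->.
split.
- move=> x; split; first exact: risk_mapping_AVaR (rho0 x).
  move=> t t0; apply: cond_risk_mapping_AVaR => Z bZ; last exact: rhoE.
  by have [] := rhoS x t Z t0 bZ.
- exact: regular_AVaR.
- move=> x Z [|t] bZ.
    (* At time 0 the shift is the identity and [w 0 = x] a.s. *)
    by apply: (start_ae polishE chainP) => w /= ->.
  have bZs : bF (Z \o @time_shift E t.+1).
    move/bounded_rvP : bZ => [mZ [M ZM]]; apply/bounded_rvP; split.
      exact: (measurableT_comp mZ (@measurable_shift E t.+1)).
    by exists M => w; exact: ZM.
  have := rhoE x t.+1 _ isT bZs; apply: filterS => w ->.
  by rewrite graft_AVaR_shift// rho0.
Qed.

End AVaR_family_markovian.

Unset Implicit Arguments.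
Set Strict Implicit.

Theorem lemma3p4 (R : realType) (E : ptopologicalType)
    (polishE : polish_space R E)
    (P : E -> probability (path_space E) R) (chainP : markov_chain P)
    (lam : R) (lam_gt0 : 0 < lam) (lam_lt1 : lam < 1) :
  (exists rho : E -> dynamic_mapping (path_space E) R, AVaR_family lam P rho) /\
  (forall rho : E -> dynamic_mapping (path_space E) R,
     AVaR_family lam P rho -> markovian P rho).
Proof.
by split; [exact: AVaR_family_exists|exact: AVaR_family_markovian].
Qed.
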